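(* Let $F:\mathbb{R}^d\to\mathbb{R}^d$ be continuous and monotone, let $H:\mathbb{R}^d\rightrightarrows\mathbb{R}^d$ be maximally monotone, and let $z^*$ satisfy $0\in F(z^* )+H(z^* )$. Let $\{z_k\}_{k\ge0}$ be generated by the Anchored Extra-Proximal (AEP) method (defined in the context) with $\rho\in[0,1]$. Then, for every $k\ge0$ for which $z_{k+1}$ is generated, $$\mathrm{res}^{\mathrm{tan}}(z_{k+1})\le\|F(z_{k+1})+v_{k+1}\|\le\frac{2\|z_0-z^*\|}{A_{k+1}}.$$
   Context: Norms are Euclidean; $\operatorname{dom}(H)=\{z:H(z)\ne\emptyset\}$. The tangent residual is $\mathrm{res}^{\mathrm{tan}}(z)=\inf_{v\in H(z)}\|F(z)+v\|$. AEP method. Input: $z_0\in\operatorname{dom}(H)$, $\rho\in[0,1]$, required accuracy $\varepsilon$. Choose $v_0\in H(z_0)$ and set $A_0=0$. For $k=0,1,2,\dots$: if $\|F(z_k)+v_k\|\le\varepsilon$, stop and return $z_k$. Otherwise choose a step size $a_k>0$ (arbitrary), set $$z_{k+1/2}=\frac{a_k}{A_k+a_k}z_0+\frac{A_k}{A_k+a_k}\bigl(z_k-a_k(F(z_k)+v_k)\bigr),$$ and find $z_{k+1}$ and $r_{k+1}$ such that $$r_{k+1}\in a_kF(z_{k+1})+a_kH(z_{k+1})+z_{k+1}-\Bigl(\frac{a_k}{A_k+a_k}z_0+\frac{A_k}{A_k+a_k}z_k\Bigr),\qquad \|r_{k+1}\|\le\rho\|z_{k+1}-z_{k+1/2}\|.$$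 Then set $A_{k+1}=A_k+a_k$ and $$v_{k+1}=\frac1{a_k}\Bigl(r_{k+1}-a_kF(z_{k+1})-z_{k+1}+\frac{a_k}{A_k+a_k}z_0+\frac{A_k}{A_k+a_k}z_k\Bigr),$$ so that $v_{k+1}\in H(z_{k+1})$. *)

(* Defs.v *)
From HB Require Import structures.
From mathcomp Require Import all_boot all_order all_algebra.
From mathcomp Require Import all_classical all_reals all_analysis.

Set Implicit Arguments.
Unset Strict Implicit.
Unset Printing Implicit Defensive.

Import Order.TTheory GRing.Theory Num.Theory.
Import numFieldNormedType.Exports.

Local Open Scope classical_set_scope.
Local Open Scope ring_scope.

(* The library norm `|x| on row vectors is the sup norm, so the Euclidean
   structure is defined here; the topology on 'rV[R]_d is the same for both
   norms, so [continuous] keeps its library meaning. *)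
Definition dotv (R : realType) (d : nat) (x y : 'rV[R]_d) : R :=
  \sum_(i < d) x ord0 i * y ord0 i.

Definition enorm (R : realType) (d : nat) (x : 'rV[R]_d) : R :=
  Num.sqrt (dotv x x).

Definition monotone_map (R : realType) (d : nat)
    (F : 'rV[R]_d -> 'rV[R]_d) : Prop :=
  forall x y, 0 <= dotv (F x - F y) (x - y).

Definition monotone_op (R : realType) (d : nat)
    (H : 'rV[R]_d -> set 'rV[R]_d) : Prop :=
  forall x y u v, H x u -> H y v -> 0 <= dotv (u - v) (x - y).

(* No monotone operator has a graph strictly containing that of H. *)
Definition maximal_monotone_op (R : realType) (d : nat)
    (H : 'rV[R]_d -> set 'rV[R]_d) : Prop :=
  monotone_op H /\
  forall G : 'rV[R]_d -> set 'rV[R]_d,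
    monotone_op G -> (forall x, H x `<=` G x) -> forall x, G x `<=` H x.

Definition op_dom (R : realType) (d : nat)
    (H : 'rV[R]_d -> set 'rV[R]_d) : set 'rV[R]_d :=
  [set z | H z !=set0].

(* Taken in \bar R so that the residual is +oo outside the domain of H; the
   real-valued [inf] would return 0 there. *)
Definition res_tan (R : realType) (d : nat) (F : 'rV[R]_d -> 'rV[R]_d)
    (H : 'rV[R]_d -> set 'rV[R]_d) (z : 'rV[R]_d) : \bar R :=
  ereal_inf [set (enorm (F z + v))%:E | v in H z].

Section AEP.
Variables (R : realType) (d : nat).
Local Notation E := 'rV[R]_d.
Variables (F : E -> E) (H : E -> set E) (rho eps : R).

(* w is the value v_k selected in H(z_k), and zk is z_k. *)
Definition aep_half (a A : R) (z0 zk w : E) : E :=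
  (a / (A + a)) *: z0 + (A / (A + a)) *: (zk - a *: (F zk + w)).

Definition aep_anchor (a A : R) (z0 zk : E) : E :=
  (a / (A + a)) *: z0 + (A / (A + a)) *: zk.

(* The k-th iteration is executed, i.e. the stopping test fails at z_k and
   z_(k+1) is generated. *)
Record aep_step (a A : nat -> R) (z v r : nat -> E) (k : nat) : Prop := {
  aep_continue : eps < enorm (F (z k) + v k);
  aep_size : 0 < a k;
  aep_incl : [set a k *: F (z k.+1) + a k *: w + z k.+1
                  - aep_anchor (a k) (A k) (z 0%N) (z k)
               | w in H (z k.+1)] (r k.+1);
  aep_error : enorm (r k.+1) <=
    rho * enorm (z k.+1 - aep_half (a k) (A k) (z 0%N) (z k) (v k));
  aep_A : A k.+1 = A k + a k;
  aep_v : v k.+1 = (a k)^-1 *: (r k.+1 - a k *: F (z k.+1) - z k.+1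
                                + aep_anchor (a k) (A k) (z 0%N) (z k)) }.

(* The first n iterations of a run.  Terms of the sequences beyond that prefix
   are unconstrained, so both terminated and infinite runs are covered. *)
Record aep_run (a A : nat -> R) (z v r : nat -> E) (n : nat) : Prop := {
  aep_z0 : op_dom H (z 0%N);
  aep_v0 : H (z 0%N) (v 0%N);
  aep_A0 : A 0%N = 0;
  aep_steps : forall k, (k < n)%N -> aep_step a A z v r k }.

End AEP.

(* Main.v *)
(* Put [g k = F (z k) + v k], an element of the monotone operator [F + H] at
   [z k].  The potential
     [A k ^+ 2 / 2 * |g k|^2 + A k * <g k, z k - z 0>]
   vanishes at [k = 0] and never increases: its decrease is a nonnegative
   combination of the monotonicity inequality between [z k] and [z k.+1] and
   of the relative error criterion with [rho <= 1].  Being nonpositive at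
   [z k.+1], it gives [A |g|^2 <= 2 <g, z 0 - z>], and monotonicity against
   [zstar] replaces [z] by [zstar] on the right. *)
Require Import Defs.
From HB Require Import structures.
From mathcomp Require Import all_boot all_order all_algebra.
From mathcomp Require Import all_classical all_reals all_analysis.
From mathcomp Require Import ring lra.
Import Order.TTheory GRing.Theory Num.Theory.
Import numFieldNormedType.Exports.
Local Open Scope classical_set_scope.
Local Open Scope ring_scope.

Section EuclideanDot.
Context {R : realType} {d : nat}.
Implicit Types x y w : 'rV[R]_d.

Lemma dotvC x y : dotv x y = dotv y x.
Proof. by apply: eq_bigr => i _; rewrite mulrC. Qed.

Lemma dotvDl x y w : dotv (x + y) w = dotv x w + dotv y w.
Proof. by rewrite -big_split; apply: eq_bigr => i _; rewrite mxE mulrDl. Qed.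

Lemma dotvZl (c : R) x w : dotv (c *: x) w = c * dotv x w.
Proof. by rewrite [RHS]mulr_sumr; apply: eq_bigr => i _; rewrite mxE mulrA. Qed.

Lemma dotvNl x w : dotv (- x) w = - dotv x w.
Proof. by rewrite -scaleN1r dotvZl mulN1r. Qed.

Lemma dotvDr x y w : dotv w (x + y) = dotv w x + dotv w y.
Proof. by rewrite dotvC dotvDl !(dotvC w). Qed.

Lemma dotvZr (c : R) x w : dotv w (c *: x) = c * dotv w x.
Proof. by rewrite dotvC dotvZl (dotvC w). Qed.

Lemma dotvNr x w : dotv w (- x) = - dotv w x.
Proof. by rewrite dotvC dotvNl (dotvC w). Qed.

Definition dotvE := (dotvDl, dotvDr, dotvNl, dotvNr, dotvZl, dotvZr).

Lemma dotv_ge0 x : 0 <= dotv x x.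
Proof. by apply: sumr_ge0 => i _; rewrite -expr2 sqr_ge0. Qed.

Lemma ler_enorm x y : (enorm x <= enorm y) = (dotv x x <= dotv y y).
Proof. by rewrite /enorm ler_psqrt ?nnegrE ?dotv_ge0. Qed.

Lemma enormZ (c : R) x : 0 <= c -> enorm (c *: x) = c * enorm x.
Proof.
move=> c0; rewrite /enorm !dotvE mulrA -expr2 sqrtrM ?sqr_ge0 //.
by rewrite sqrtr_sqr ger0_norm.
Qed.

(** Expanding [0 <= |x - 2 y|^2] suffices, so no Cauchy-Schwarz inequality is needed. *)
Lemma enorm_le_twice x y : dotv x x <= 2 * dotv x y -> enorm x <= 2 * enorm y.
Proof.
move=> xy; rewrite -enormZ // ler_enorm.
have := dotv_ge0 (x - 2 *: y); rewrite !dotvE (dotvC y x); lra.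
Qed.

End EuclideanDot.

Lemma monotone_sum {R : realType} {d : nat} {F : 'rV[R]_d -> 'rV[R]_d}
    {H : 'rV[R]_d -> set 'rV[R]_d} {x y u w : 'rV[R]_d} :
  monotone_map F -> monotone_op H -> H x u -> H y w ->
  0 <= dotv ((F x + u) - (F y + w)) (x - y).
Proof.
move=> mF mH Hx Hy; rewrite opprD addrACA dotvDl.
by rewrite addr_ge0 // ?mF // mH.
Qed.

Definition aep_potential {R : realType} {d : nat} (A : R) (z0 z g : 'rV[R]_d) : R :=
  A ^+ 2 / 2 * dotv g g + A * dotv g (z - z0).

(** One iteration with [F] and [H] abstracted into [g] and [g']. The vector on the right of the last
    hypothesis is [z'] minus the half-step point, so that hypothesis is the error criterion with
    [rho] relaxed to 1. *)
Lemma aep_potential_decr {R : realType} {d : nat} {a A : R}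
    {z0 z z' g g' r : 'rV[R]_d} :
  0 < a -> 0 <= A ->
  z' = aep_anchor a A z0 z + r - a *: g' ->
  0 <= dotv (g' - g) (z' - z) ->
  enorm r <= enorm (r - a *: g' + (A * a / (A + a)) *: g) ->
  aep_potential (A + a) z0 z' g' <= aep_potential A z0 z g.
Proof.
move=> a0 A0 z'E; set t := a / (A + a).
have B0 : A + a != 0 by rewrite gt_eqF ?ltr_wpDl.
have t0 : 0 < t by rewrite divr_gt0 // ltr_wpDl.
have AtE : A / (A + a) = 1 - t by rewrite /t; field.
have AaE : A * a / (A + a) = A * t by rewrite /t mulrA.
(* Both displacements are written through [z - z0], so that only the inner products of [r], [g],
   [g'] and [u = z - z0] remain. *)
have z'z : z' - z = r - a *: g' - t *: (z - z0).
  rewrite z'E /aep_anchor AtE -/t; apply/rowP => i; rewrite !mxE; ring.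
have z'z0 : z' - z0 = r - a *: g' + (1 - t) *: (z - z0).
  rewrite z'E /aep_anchor AtE -/t; apply/rowP => i; rewrite !mxE; ring.
rewrite z'z AaE ler_enorm /aep_potential z'z0.
move: (z - z0) => u mono err.
(* Scaled by [2 t^2], the decrease is exactly [2 t A] times the monotonicity term plus the gap in
   the squared error criterion; the [|g|^2] terms match as [(A t)^2]. *)
rewrite -subr_ge0 -(@pmulr_rge0 _ (2 * t ^+ 2)); last first.
  by rewrite mulr_gt0 // exprn_gt0.
have -> : 2 * t ^+ 2 * (A ^+ 2 / 2 * dotv g g + A * dotv g u -
    ((A + a) ^+ 2 / 2 * dotv g' g' +
     (A + a) * dotv g' (r - a *: g' + (1 - t) *: u))) =
  2 * t * A * dotv (g' - g) (r - a *: g' - t *: u) +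
  (dotv (r - a *: g' + (A * t) *: g) (r - a *: g' + (A * t) *: g)
   - dotv r r).
  rewrite !dotvE (dotvC r g') (dotvC r g) (dotvC g g') /t.
  by field.
apply: addr_ge0; last by rewrite subr_ge0.
by apply: mulr_ge0 mono; apply: mulr_ge0 A0; apply: mulr_ge0 (ltW t0).
Qed.

Section Run.
Context {R : realType} {d : nat} {F : 'rV[R]_d -> 'rV[R]_d}.
Context {H : 'rV[R]_d -> set 'rV[R]_d} {rho eps : R}.
Context {a A : nat -> R} {z v r : nat -> 'rV[R]_d}.

(** The formula for [v k.+1] inverts the inclusion for [r k.+1], so it recovers the very [w] chosen
    there. *)
Lemma aep_step_mem {k} : aep_step F H rho eps a A z v r k -> H (z k.+1) (v k.+1).
Proof.
move=> [_ a0 [w Hw rE] _ _ ->]; rewrite -rE.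
suff -> : a k *: F (z k.+1) + a k *: w + z k.+1
    - aep_anchor (a k) (A k) (z 0%N) (z k) - a k *: F (z k.+1) - z k.+1
    + aep_anchor (a k) (A k) (z 0%N) (z k) = a k *: w.
  by rewrite scalerA mulVf ?scale1r // gt_eqF.
by apply/rowP => i; rewrite !mxE; ring.
Qed.

Lemma aep_stepE {k} : aep_step F H rho eps a A z v r k ->
  z k.+1 = aep_anchor (a k) (A k) (z 0%N) (z k) + r k.+1
           - a k *: (F (z k.+1) + v k.+1).
Proof.
move=> [_ a0 _ _ _ ->].
rewrite scalerDr scalerA mulfV ?scale1r ?gt_eqF //.
by apply/rowP => i; rewrite !mxE; ring.
Qed.

Lemma aep_step_potential {k} :
  monotone_map F -> monotone_op H -> rho <= 1 ->
  H (z k) (v k) -> 0 <= A k -> aep_step F H rho eps a A z v r k ->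
  aep_potential (A k.+1) (z 0%N) (z k.+1) (F (z k.+1) + v k.+1) <=
  aep_potential (A k) (z 0%N) (z k) (F (z k) + v k).
Proof.
move=> mF mH rho1 Hk A0 st; rewrite (aep_A st).
apply: (aep_potential_decr (aep_size st) A0 (aep_stepE st)).
  exact: (monotone_sum mF mH (aep_step_mem st) Hk).
have -> : r k.+1 - a k *: (F (z k.+1) + v k.+1)
    + (A k * a k / (A k + a k)) *: (F (z k) + v k) =
    z k.+1 - aep_half F (a k) (A k) (z 0%N) (z k) (v k).
  rewrite [in RHS](aep_stepE st) /aep_half /aep_anchor.
  by apply/rowP => i; rewrite !mxE; ring.
by apply: le_trans (aep_error st) _; rewrite ler_piMl // sqrtr_ge0.
Qed.

(** The first two conjuncts are carried along because the descent of the potential at the next step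
    requires them. *)
Lemma aep_run_invariant {n} :
  monotone_map F -> monotone_op H -> rho <= 1 ->
  aep_run F H rho eps a A z v r n ->
  forall k, (k <= n)%N ->
  [/\ H (z k) (v k), 0 <= A k &
      aep_potential (A k) (z 0%N) (z k) (F (z k) + v k) <= 0].
Proof.
move=> mF mH rho1 [_ H0 A00 steps]; elim=> [_|k IH kn].
  by split; rewrite // ?A00 // /aep_potential expr0n !mul0r addr0.
have [Hk Ak Vk] := IH (ltnW kn); have st := steps _ kn; split.
- exact: aep_step_mem st.
- by rewrite (aep_A st) addr_ge0 // ltW // (aep_size st).
- exact: le_trans (aep_step_potential mF mH rho1 Hk Ak st) Vk.
Qed.

End Run.

Theorem theorem3p2 (R : realType) (d : nat)
    (F : 'rV[R]_d -> 'rV[R]_d) (H : 'rV[R]_d -> set 'rV[R]_d)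
    (zstar : 'rV[R]_d) (rho eps : R)
    (a A : nat -> R) (z v r : nat -> 'rV[R]_d) (n : nat)
    (F_cont : continuous F)
    (F_mono : monotone_map F)
    (H_max : maximal_monotone_op H)
    (zstar_sol : [set F zstar + w | w in H zstar] 0)
    (rho01 : 0 <= rho <= 1)
    (run : aep_run F H rho eps a A z v r n) :
  forall k : nat, (k < n)%N ->
    (res_tan F H (z k.+1) <= (enorm (F (z k.+1) + v k.+1))%:E)%E /\
    enorm (F (z k.+1) + v k.+1) <= 2 * enorm (z 0%N - zstar) / A k.+1.
Proof.
move=> k kn; have [mH _] := H_max; have /andP[_ rho1] := rho01.
have [Hk _ Vk] := aep_run_invariant F_mono mH rho1 run _ kn.
have [_ A0 _] := aep_run_invariant F_mono mH rho1 run _ (ltnW kn).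
have st := aep_steps run kn.
have A'0 : 0 < A k.+1 by rewrite (aep_A st) ltr_wpDl // (aep_size st).
split; first by apply: ereal_inf_lbound; exists (v k.+1).
(* With [A k.+1] absorbed into the norm, the target becomes [A^2 |g|^2 <= 2 A <g, z 0 - zstar>]. *)
rewrite ler_pdivlMr // (mulrC _ (A k.+1)) -(enormZ (A k.+1)) ?(ltW A'0) //.
apply: enorm_le_twice.
have [w Hw w0] := zstar_sol.
have := monotone_sum F_mono mH Hk Hw; rewrite w0 subr0.
move: Vk; rewrite /aep_potential.
move: (F (z k.+1) + v k.+1) => g; rewrite !dotvE => Vk mono.
(* Multiplying by [A k.+1] beforehand leaves a goal linear in the products, within reach of
   [lra]. *)
have : 0 <= A k.+1 * (dotv g (z k.+1) - dotv g zstar).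
  by apply: mulr_ge0 mono; exact: ltW.
lra.
Qed.
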